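(* Let $q$ be a prime power and let $n\geq 3$ be an integer. Every equidistant single-orbit cyclic subspace code in $\mathcal{P}_q(n)$ is trivial. That is: if $U$ is an $\mathbb{F}_q$-subspace of $\mathbb{F}_{q^n}$ such that $\mathrm{Orb}(U)$ is an equidistant subspace code, and $t$ is the integer with $\mathrm{Stab}(U)\cup\{0\}=\mathbb{F}_{q^t}$, then $\dim_{\mathbb{F}_q}(U)=t$ or $\dim_{\mathbb{F}_q}(U)=n-t$.
   Context: $\mathcal{P}_q(n)$ is the set of all $\mathbb{F}_q$-subspaces of $\mathbb{F}_q^n$, identified with the $\mathbb{F}_q$-subspaces of $\mathbb{F}_{q^n}$, with the metric $d_s(U,V)=\dim U+\dim V-2\dim(U\cap V)$. A subspace code is a subset of $\mathcal{P}_q(n)$ with at least two elements; it has constant dimension if all its elements have the same dimension. A constant dimension subspace code $C$ is equidistant if $d_s(V,W)$ takes the same value for all distinct $V,W\in C$. For an $\mathbb{F}_q$-subspace $U$ of $\mathbb{F}_{q^n}$, $\alpha U=\{\alpha u\mid u\in U\}$, $\mathrm{Orb}(U)=\{\alpha U\mid \alpha\in\mathbb{F}_{q^n}^*\}$ (a single-orbit cyclic subspace code) and $\mathrm{Stab}(U)=\{\alpha\in\mathbb{F}_{q^n}^*\mid \alpha U=U\}$. It is known that $\mathrm{Stab}(U)\cup\{0\}$ is a subfield of $\mathbb{F}_{q^n}$ containing $\mathbb{F}_q$, so it equals $\mathbb{F}_{q^t}$ for some $t\mid n$. Since a code has at least two elements, $t<n$. An equidistant code $\mathrm{Orb}(U)$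 is called trivial if $\dim_{\mathbb{F}_q}(U)\in\{t,n-t\}$. *)

(* Defs.v *)
From HB Require Import structures.
From mathcomp Require Import all_boot all_order all_fingroup all_algebra all_field.

Set Implicit Arguments.
Unset Strict Implicit.
Unset Printing Implicit Defensive.

Import GRing.Theory.
Local Open Scope ring_scope.

(* The ambient space is a degree n extension L of a finite field F of order q, *)
(* so that {vspace L} is the set of F_q-subspaces of F_{q^n}.                  *)

Section SubspaceCodes.

Variables (F : finFieldType) (L : fieldExtType F).
Implicit Types (U V W : {vspace L}) (C : {vspace L} -> Prop).

(* The truncated subtraction is exact, see [subspace_distE]. *)
Definition subspace_dist U V : nat :=
  (\dim U + \dim V - 2 * \dim (U :&: V))%N.

Definition subspace_code C : Prop := exists U V, [/\ C U, C V & U != V].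

Definition constant_dimension C : Prop :=
  forall U V, C U -> C V -> \dim U = \dim V.

(* If C has only two elements there is a single distance to compare. *)
Definition equidistant C : Prop :=
  [/\ subspace_code C, constant_dimension C &
      exists d : nat, forall V W, C V -> C W -> V != W -> subspace_dist V W = d].

Definition scalev (a : L) U : {vspace L} := (amull a @: U)%VS.

Definition Orb U : {vspace L} -> Prop :=
  fun V => exists2 a : L, a != 0 & V = scalev a U.

Definition Stab U : pred L := [pred a | (a != 0) && (scalev a U == U)].

(* S is the subfield F_{q^t} of L. As q = #|F|, the subfields of L with q^t    *)
(* elements that contain F are those of dimension t over F, and a finite field *)
(* has at most one subfield of each order.                                     *)
Definition is_Fqt (S : pred L) (t : nat) : Prop :=
  exists2 K : {subfield L}, \dim K = t & S =i K.

Lemma subspace_distE U V :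
  (subspace_dist U V + 2 * \dim (U :&: V) = \dim U + \dim V)%N.
Proof.
rewrite /subspace_dist subnK // mul2n -addnn.
by rewrite leq_add // dimvS ?capvSl ?capvSr.
Qed.

Lemma mem_scalev a U v :
  reflect (exists2 u, u \in U & v = a * u) (v \in scalev a U).
Proof.
by apply: (iffP memv_imgP) => -[u Uu ->]; exists u; rewrite ?lfunE.
Qed.

Lemma Stab_subfield U : exists t, is_Fqt [predU1 0 & Stab U] t.
Proof.
pose S := (\bigcap_(i < \dim U) (amulr (vbasis U)`_i @^-1: U))%VS.
have SP a : reflect (forall u, u \in U -> a * u \in U) (a \in S).
  rewrite memvE; apply: (iffP subv_bigcapP) => [aU u Uu | aU i _].
    rewrite (coord_vbasis Uu) mulr_sumr rpred_sum // => i _.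
    rewrite -scalerAr rpredZ //.
    by have := aU i isT; rewrite -memvE -memv_preim lfunE.
  by rewrite -memvE -memv_preim lfunE /= aU // vbasis_mem // mem_nth ?size_tuple.
have S1 : 1 \in S by apply/SP => u; rewrite mul1r.
have Salg : is_aspace S.
  rewrite /is_aspace has_algid1 //=; apply/prodvP => a b /SP aU /SP bU.
  by apply/SP => u Uu; rewrite -mulrA aU // bU.
pose K : {subfield L} := ASpace Salg.
exists (\dim K), K => // a; rewrite !inE.
have [-> | nz_a] /= := eqVneq a 0; first by rewrite mem0v.
apply/eqP/SP => [aU u Uu | aU].
  by rewrite -aU; apply/mem_scalev; exists u.
apply/eqP; rewrite eqEdim limg_dim_eq ?leqnn ?andbT.
  by apply/subvP => v /mem_scalev[u /aU Uau ->].
by rewrite (eqP (lker0_amull _)) ?capv0 // unitfE.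
Qed.

End SubspaceCodes.

(* Main.v *)
Require Import Defs.
From HB Require Import structures.
From mathcomp Require Import all_boot all_order all_fingroup all_algebra all_field.
From mathcomp Require Import zify.

Import GRing.Theory.
Local Open Scope ring_scope.

(* If U has dimension k and meets a U in dimension l for every a outside its
   stabiliser, counting the triples (a, u, w) of nonzero elements with u, w in U
   and w = a u in two ways gives
     (q^k - 1)^2 = (q^t - 1)(q^k - 1) + (q^n - q^t)(q^l - 1).
   If k is not t, then l > 0, and the expanded equation
     q^(2k) + q^n + q^(t+l) = q^(n+l) + q^k + q^(k+t)
   forces k = t + l, because q^k and q^(t+l) must have the same q-adic valuation.
   What remains is then (q^l - 1) q^(k+t) = (q^l - 1) q^n, so k + t = n. *)

Lemma orbit_exponents (q n k t l : nat) :
    (1 < q)%N -> (0 < k < n)%N -> (0 < t)%N -> (0 < l)%N ->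
    (q ^ (k + k) + q ^ n + q ^ (t + l) = q ^ (n + l) + q ^ k + q ^ (k + t))%N ->
  (k = n - t)%N.
Proof.
move=> q_gt1 /andP[k_gt0 ltkn] t_gt0 l_gt0 E.
have qdvd a b : (a <= b)%N -> (q ^ a %| q ^ b)%N by move=> *; apply: dvdn_exp2l.
have qndvd a : ~ (q ^ a.+1 %| q ^ a)%N.
  by move/dvdn_leq; rewrite expn_gt0 (ltnW q_gt1) leq_exp2l // ltnn => /(_ isT).
(* If k < t + l, then q^(k+1) divides every term of [E] except q^k. *)
have letlk : (t + l <= k)%N.
  rewrite leqNgt; apply/negP => ltktl; apply: (qndvd k).
  have: (q ^ k.+1 %| q ^ (k + k) + q ^ n + q ^ (t + l))%N.
    by rewrite !dvdn_add ?qdvd //; lia.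
  by rewrite E dvdn_addl ?dvdn_addr //; apply: qdvd; lia.
(* If t + l < k, then q^(t+l+1) divides every term of [E] except q^(t+l). *)
have lektl : (k <= t + l)%N.
  rewrite leqNgt; apply/negP => lttlk; apply: (qndvd (t + l)%N).
  have: (q ^ (t + l).+1 %| q ^ (n + l) + q ^ k + q ^ (k + t))%N.
    by rewrite !dvdn_add ?qdvd //; lia.
  by rewrite -E dvdn_addr // dvdn_add // qdvd //; lia.
have defk : k = (t + l)%N by lia.
have ql_gt1 : (1 < q ^ l)%N by rewrite -(expn0 q) ltn_exp2l.
suff /eqP: (q ^ (k + t) = q ^ n)%N by rewrite eqn_exp2l //; lia.
have {E} : (q ^ (k + t) * q ^ l + q ^ n = q ^ n * q ^ l + q ^ (k + t))%N.
  have kk : (k + k = k + t + l)%N by lia.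
  by move: E; rewrite -defk kk !expnD; lia.
nia.
Qed.

(** Here [m] stands for the number q^n - q^t of scalars outside the stabiliser field. *)
Lemma solve_orbit_count (q n k t l m : nat) :
    (1 < q)%N -> (0 < k < n)%N -> (0 < t)%N ->
    ((q ^ t).-1 + m = (q ^ n).-1)%N ->
    ((q ^ t).-1 * (q ^ k).-1 + m * (q ^ l).-1 = (q ^ k).-1 ^ 2)%N ->
  k = t \/ k = (n - t)%N.
Proof.
move=> q_gt1 k_bounds t_gt0.
have qS i : (q ^ i = (q ^ i).-1.+1)%N by rewrite prednK // expn_gt0 ltnW.
have [->|k_neq_t] := eqVneq k t; first by left.
(* For l = 0 the term with [m] vanishes; cancelling q^k - 1 > 0 leaves q^t = q^k, against k <> t. *)
have [->|l_gt0] := posnP l => defm E; last right.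
  move: E; rewrite muln0 addn0 expnS expn1 => /eqP.
  rewrite eqn_pmul2r; last first.
    by have := @ltn_exp2l q 0 k q_gt1; rewrite expn0; lia.
  by rewrite -eqSS -!qS eqn_exp2l // eq_sym (negPf k_neq_t).
apply: (@orbit_exponents q n k t l) => //.
rewrite !expnD (qS k) (qS n) (qS t) (qS l) -defm.
by move: E; rewrite expnS expn1; lia.
Qed.

Section OrbitIntersections.

Variables (F : finFieldType) (L : fieldExtType F).
Implicit Types (U V : {vspace L}) (a : L).

Lemma scale1v U : scalev 1 U = U.
Proof.
apply/vspaceP => v; apply/mem_scalev/idP => [[u Uu ->]|Uv].
  by rewrite mul1r.
by exists v; rewrite ?mul1r.
Qed.

Lemma mem_scalevV a U v : a != 0 -> (v \in scalev a U) = (v / a \in U).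
Proof.
move=> a0; apply/mem_scalev/idP => [[u Uu ->]|Uv].
  by rewrite mulrAC divff ?mul1r.
by exists (v / a); rewrite // mulrC divfK.
Qed.

Lemma dim_scalev a U : a != 0 -> \dim (scalev a U) = \dim U.
Proof.
by move=> a0; rewrite limg_dim_eq // (eqP (lker0_amull _)) ?capv0 // unitfE.
Qed.

(** Serves to exclude the zero space and the whole space, whose orbits have one element. *)
Lemma scalev_trivial a U : a != 0 -> \dim U = 0 \/ \dim U = \dim {:L} ->
  scalev a U = U.
Proof.
move=> a0 dimU; apply/eqP; rewrite eq_sym eqEdim dim_scalev // leqnn andbT.
case: dimU => [/eqP|dimU]; first by rewrite dimv_eq0 => /eqP->; apply: sub0v.
have -> : scalev a U = fullv.
  by apply/eqP; rewrite eqEdim subvf dim_scalev ?dimU /=.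
exact: subvf.
Qed.

Let T : finFieldType := finvect_type L.

Lemma card_vspaceD1 U :
  #|[pred u : T | (u != 0) && (u \in U)]| = (#|F| ^ \dim U).-1.
Proof.
have -> : (#|F| ^ \dim U)%N = #|[pred u : T | u \in U]|.
  exact/esym/(@card_vspace F T (Vector.class (finvect_type L)) U).
rewrite [in RHS](cardD1 (0 : T)) inE mem0v add1n /=; apply: eq_card => u.
by rewrite !inE.
Qed.

(** Double counting, valid for every [U]: a fixed a admits the nonzero w in the intersection, while
    nonzero u and w in [U] determine a = w / u, whence the square. *)
Lemma sum_orbit_intersections U :
  (\sum_(a : T | a != 0%R) (#|F| ^ \dim (U :&: scalev (a : L) U)).-1 =
   (#|F| ^ \dim U).-1 ^ 2)%N.
Proof.
transitivity (\sum_(a : T | a != 0%R)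
    \sum_(w : T | (w != 0%R) && (w \in U)) (w / a \in U)%R)%N.
  apply: eq_bigr => a a0; rewrite -card_vspaceD1 -big_mkcondr /= sum1_card.
  by apply: eq_card => w; rewrite !inE memv_cap mem_scalevV // andbA.
rewrite exchange_big /= -card_vspaceD1 expnS expn1.
rewrite -sum_nat_const; apply: eq_bigr => w /andP[w0 Uw].
rewrite -big_mkcondr /= -sum1_card.
(* For fixed w, the involution a -> w / a turns the condition w / a in [U] into a in [U]. The value
   a = 0 is excluded on both sides, as its inverse is 0 by convention. *)
rewrite (reindex_onto (fun a : T => w / a) (fun a : T => w / a)) /=.
  apply: eq_bigl => a; rewrite inE.
  have [->|a0] := eqVneq a 0; first by rewrite invr0 mulr0 eqxx.
  by rewrite !invf_div mulrCA divff // mulr1 eqxx mulf_neq0 ?invr_eq0 // andbT.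
by move=> a /andP[a0 _]; rewrite invf_div mulrCA divff // mulr1.
Qed.

End OrbitIntersections.

Theorem theorem7 (q n : nat) (F : finFieldType) (L : fieldExtType F)
    (hq : #|F| = q) (hn : (3 <= n)%N) (hL : \dim {:L} = n)
    (U : {vspace L}) (hU : equidistant (Orb U))
    (t : nat) (ht : is_Fqt [predU1 0 & Stab U] t) :
  \dim U = t \/ \dim U = (n - t)%N.
Proof.
case: hU => -[V [W [[a a0 defV] [b b0 defW] neqVW]]] _ [d distd].
case: ht => K dimK defK.
have q_gt1 : (1 < q)%N by rewrite -hq finRing_gt1.
have k_nontriv : (0 < \dim U < n)%N.
  rewrite lt0n ltn_neqAle -{2}hL dimvS ?subvf // andbT -negb_or.
  apply: contra neqVW => triv; have triv' : \dim U = 0 \/ \dim U = \dim {:L}.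
    by rewrite hL; case/orP: triv => /eqP; [left | right].
  by rewrite defV defW !scalev_trivial.
have t_gt0 : (0 < t)%N.
  rewrite -dimK lt0n dimv_eq0 -subv0.
  by apply/subvP => /(_ _ (mem1v K)); rewrite memv0 oner_eq0.
have stabK c : c != 0 -> c \in K -> scalev c U = U.
  by move=> c0; rewrite -defK !inE (negPf c0) => /eqP.
(* Solves d = 2k - 2l: for c outside [K], the spaces 1 U = U and c U are distinct members of the
   orbit. *)
pose l := ((\dim U + \dim U - d) %/ 2)%N.
have dim_cap c : c != 0 -> c \notin K -> \dim (U :&: scalev c U) = l.
  move=> c0; rewrite -defK !inE negb_or c0 /= => cU.
  have := subspace_distE U (scalev c U).
  rewrite dim_scalev // (distd U (scalev c U)).
  - rewrite /l; lia.
  - by exists 1; rewrite ?oner_eq0 ?scale1v.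
  - by exists c.
  by rewrite eq_sym.
have := sum_orbit_intersections _ _ U; rewrite hq.
pose T : finFieldType := finvect_type L.
(* Scalars in [K] fix [U] and contribute q^k - 1 each; all others contribute q^l - 1. *)
rewrite (bigID (fun a : T => a \in K)) /=.
rewrite (eq_bigr (fun=> (q ^ \dim U).-1)); last first.
  by move=> c /andP[c0 cK]; rewrite stabK ?capvv.
rewrite sum_nat_const card_vspaceD1 hq dimK.
rewrite (eq_bigr (fun=> (q ^ l).-1)); last first.
  by move=> c /andP[c0 cK]; rewrite dim_cap.
rewrite sum_nat_const.
(* Splitting the q^n - 1 nonzero elements of [fullv] along [K] gives the equation that determines
   [m]. *)
pose KT : pred T := fun c => c \in K.
have := cardID KT [pred c : T | (c != 0) && (c \in fullv)].
have -> : #|[predI [pred c : T | (c != 0) && (c \in fullv)] & KT]| =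
          #|[pred c : T | (c != 0) && (c \in K)]|.
  by apply: eq_card => c; rewrite !inE memvf andbT.
have -> : #|[predD [pred c : T | (c != 0) && (c \in fullv)] & KT]| =
          #|[pred c : T | (c != 0) && (c \notin K)]|.
  by apply: eq_card => c; rewrite !inE memvf andbT andbC.
rewrite !card_vspaceD1 hq hL dimK; exact: solve_orbit_count.
Qed.
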